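(* Let $n\ge 11$ and $k$ be positive integers and let $d=n-2k$ satisfy $4\le d\le n-8$. Let $T_{n,d}=\frac{n(n+1)}{2}-d$. Then there is a bijection between $\mathbb U^*_{T_{n,d}}$ and $\mathbb D^{\mathrm{odd}}_{2(k+1)}$; in particular $\#\mathbb U^*_{T_{n,d}}=\#\mathbb D^{\mathrm{odd}}_{2(k+1)}$.
   Context: A partition of $N$ into distinct parts is a sequence of positive integers $\lambda_1<\dots<\lambda_t$ summing to $N$ with $t\ge 2$; $\mathbb D_N$ is the set of these and $\mathbb D^{\mathrm{odd}}_N$ the subset with all parts odd. Missing parts of $\lambda$: elements of $\{1,\dots,\lambda_t\}\setminus\{\lambda_1,\dots,\lambda_t\}$. $\lambda$ is refinable if two distinct missing parts sum to a part of $\lambda$, unrefinable otherwise; $\mathbb U_N$ is the set of unrefinable partitions of $N$. $\mathbb U^*_N$ is the set of $\lambda\in\mathbb U_N$ whose largest part is the maximum of the largest parts over all of $\mathbb U_N$. Standing assumption: $n\ge 11$. *)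

(* Defs.v *)
From HB Require Import structures.
From mathcomp Require Import all_boot.

Set Implicit Arguments.
Unset Strict Implicit.
Unset Printing Implicit Defensive.

Definition is_dpart (N : nat) (s : seq nat) : bool :=
  [&& sorted ltn s, all (ltn 0) s, sumn s == N & 2 <= size s].

Record dpart (N : nat) := DPart { parts :> seq nat; dpartP : is_dpart N parts }.

HB.instance Definition _ N := [isSub for @parts N].
HB.instance Definition _ N := [Countable of dpart N by <:].

(* Finiteness: a partition of N into distinct parts is determined by its set of
   parts, a subset of {0, ..., N}. *)
Definition dpart_set N (l : dpart N) : {set 'I_N.+1} :=
  [set i : 'I_N.+1 | val i \in parts l].

Definition set_dpart N (A : {set 'I_N.+1}) : option (dpart N) :=
  insub [seq val i | i <- enum A].

Lemma dpart_setK N : pcancel (@dpart_set N) (@set_dpart N).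
Proof.
move=> [s Ps]; rewrite /set_dpart /dpart_set /=.
suff -> : [seq val i | i <- enum [set i : 'I_N.+1 | val i \in s]] = s.
  by rewrite insubT.
have /and4P[srt _ /eqP sN _] := Ps.
apply: (irr_sorted_eq ltn_trans ltnn) => //.
  rewrite /enum_mem sorted_map; apply: sorted_filter.
    by move=> y x z; apply: ltn_trans.
  by rewrite -sorted_map -enumT val_enum_ord iota_ltn_sorted.
move=> x; apply/mapP/idP => [[i]|xs].
  by rewrite mem_enum inE => ? ->.
have ltxN : x < N.+1.
  by rewrite ltnS -sN sumnE (big_rem x) //= leq_addr.
by exists (Ordinal ltxN); rewrite // mem_enum inE.
Qed.

HB.instance Definition _ N : isFinite (dpart N) :=
  PCanIsFinite (@dpart_setK N).

(* Correct because the parts are listed in increasing order. *)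
Definition largest_part (s : seq nat) : nat := last 0 s.

Definition missing_parts (s : seq nat) : seq nat :=
  [seq m <- iota 1 (largest_part s) | m \notin s].

Definition refinable (s : seq nat) : bool :=
  has (fun a => has (fun b => (a != b) && (a + b \in s)) (missing_parts s))
      (missing_parts s).

Definition Dodd (N : nat) : {set dpart N} :=
  [set l : dpart N | all odd (parts l)].

Definition U (N : nat) : {set dpart N} :=
  [set l : dpart N | ~~ refinable (parts l)].

Definition Ustar (N : nat) : {set dpart N} :=
  [set l in U N |
    largest_part (parts l) == \max_(m in U N) largest_part (parts m)].

(* Used only for d <= n, so that the subtraction is not truncated. *)
Definition T (n d : nat) : nat := (n * n.+1)./2 - d.

(* Main.v *)
(* Put m = n - 3 and e = 2(k + 1), so that T n d = m(m+1)/2 + (2m + 1) + e with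
   e <= m + 1. If the largest part of an unrefinable partition is L, each pair
   {a, L - a} contains a part; keeping only the smaller member of each pair
   gives the least possible sum, so L <= 2m + 2. For L = 2m + 2 the remaining
   sum e - 1 is odd and at most m, but it could only be spent on exchanging a
   for L - a, which always adds an even amount; hence L <= 2m + 1. For
   L = 2m + 1 the exchanges add the distinct odd amounts L - 2a, and these
   amounts form a partition of e into distinct odd parts. The single exception,
   possible only for e = m + 1, is to keep both m and m + 1; it compensates for
   the single odd partition, {1, m}, whose exchanges produce a refinable
   result. *)
Require Import Defs.
From mathcomp Require Import all_boot zify.

Set Implicit Arguments.
Unset Strict Implicit.
Unset Printing Implicit Defensive.

(** * Sums over strictly increasing sequences and their splitting into pairs *)

Lemma sorted_ltn_eq_filter s B :
  sorted ltn s -> all (gtn B) s -> s = [seq x <- iota 0 B | x \in s].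
Proof.
move=> s_srt /allP s_lt; apply: (irr_sorted_eq ltn_trans ltnn) => //.
  by apply: sorted_filter (iota_ltn_sorted 0 B) => y x z; apply: ltn_trans.
move=> x; rewrite mem_filter mem_iota /= add0n.
by case xs: (x \in s) => //=; have /= -> := s_lt x xs.
Qed.

Lemma sumn_sorted_ltn s B : sorted ltn s -> all (gtn B) s ->
  sumn s = \sum_(0 <= x < B) (x \in s) * x.
Proof.
move=> s_srt s_lt; rewrite {1}(sorted_ltn_eq_filter s_srt s_lt) sumnE.
rewrite big_filter big_mkcond /index_iota subn0; apply: eq_bigr => x _.
by case: (x \in s); rewrite ?mul1n.
Qed.

Lemma sorted_ltn_le_last s x : sorted ltn s -> x \in s -> x <= last 0 s.
Proof.
move=> s_srt xs; rewrite -nth_last -{1}(nth_index 0 xs).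
have ixs : index x s < size s by rewrite index_mem.
by rewrite (sorted_leq_nth leq_trans leqnn 0 (sub_sorted ltnW s_srt)) ?inE; lia.
Qed.

Lemma sumn_rem x s : x \in s -> sumn s = x + sumn (rem x s).
Proof. by move=> xs; rewrite (perm_sumn (perm_to_rem xs)). Qed.

Lemma leq_sumn_sub t s : uniq t -> {subset t <= s} -> sumn t <= sumn s.
Proof.
elim: t s => [|x t IHt] s //= /andP[xt t_uniq] ts.
have xs : x \in s by apply: ts; rewrite mem_head.
rewrite (sumn_rem xs) leq_add2l IHt // => y yt.
have := ts y; rewrite inE yt orbT => /(_ isT).
rewrite (perm_mem (perm_to_rem xs)) inE => /predU1P[yx|//].
by rewrite -yx yt in xt.
Qed.

(** The pairs [{M - i, L - M + i}] all have total [L]. The middle range left over is empty for L =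
    2M + 1 and a single point for L = 2M + 2. *)
Lemma sum_pairs (F : nat -> nat) M L : M.*2 < L ->
  \sum_(0 <= x < L.+1) F x =
  F 0 + \sum_(i < M) (F (M - i) + F (L - M + i))
    + \sum_(M.+1 <= x < L - M) F x + F L.
Proof.
move=> ltML; rewrite big_nat_recr //= (@big_cat_nat _ _ _ 1) //=; last lia.
rewrite big_nat1 (@big_cat_nat _ _ _ M.+1) //=; try lia.
rewrite (@big_cat_nat _ _ _ (L - M) M.+1) //=; try lia.
rewrite big_split /=.
have -> : \sum_(1 <= x < M.+1) F x = \sum_(i < M) F (M - i).
  rewrite big_nat_rev /= big_add1 big_mkord /=.
  by apply: eq_bigr => i _; congr F; lia.
have -> : \sum_(L - M <= x < L) F x = \sum_(i < M) F (L - M + i).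
  rewrite -{1}[L - M]add0n big_addn (_ : L - (L - M) = M); last lia.
  by rewrite big_mkord; apply: eq_bigr => i _; congr F; lia.
by rewrite [\sum_(M.+1 <= _ < _) _ + _]addnC !addnA.
Qed.

Lemma sum_rev_half m : \sum_(i < m) (m - i) = (m * m.+1)./2.
Proof.
elim: m => [|m IHm]; first by rewrite big_ord0.
rewrite big_ord_recl subn0 (eq_bigr (fun i : 'I_m => m - i)) ?IHm; first lia.
by move=> i _; rewrite /= subSS.
Qed.

Lemma sum_odd_part (F : nat -> nat) m : (forall x, ~~ odd x -> F x = 0) ->
  \sum_(0 <= x < m.*2) F x = \sum_(i < m) F i.*2.+1.
Proof.
move=> F0; elim: m => [|m IHm]; first by rewrite big_ord0 big_nil.
rewrite big_ord_recr /= -IHm doubleS !big_nat_recr //= (F0 m.*2) ?addn0 //.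
by rewrite odd_double.
Qed.

Lemma sum_odd_double n (g : 'I_n -> nat) :
  (forall i, ~~ odd (g i)) -> ~~ odd (\sum_i g i).
Proof.
by move=> g_even; elim/big_ind: _ => // x y; rewrite oddD => /negPf-> /negPf->.
Qed.

(** * Missing parts and the bound on the largest part *)

Lemma missing_partsE s x :
  (x \in missing_parts s) = [&& 0 < x, x <= largest_part s & x \notin s].
Proof. by rewrite mem_filter mem_iota add1n ltnS andbC andbA. Qed.

Lemma refinableP s : reflect (exists a b,
  [/\ a \in missing_parts s, b \in missing_parts s, a != b & a + b \in s])
  (refinable s).
Proof.
apply: (iffP hasP) => [[a am /hasP[b bm /andP[ab abs]]]|[a [b [am bm ab abs]]]].
  by exists a, b.
by exists a => //; apply/hasP; exists b => //; rewrite ab.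
Qed.

Lemma unrefinable_pair s a b : ~~ refinable s -> largest_part s = a + b ->
  a + b \in s -> 0 < a -> 0 < b -> a != b -> (a \in s) || (b \in s).
Proof.
move=> /refinableP nref sL abs a0 b0 ab; case: (boolP (a \in s)) => //= nas.
apply/negPn/negP => nbs; apply: nref; exists a, b.
by rewrite !missing_partsE sL a0 b0 nas nbs leq_addr leq_addl.
Qed.

Lemma largest_part_mem N s : is_dpart N s -> largest_part s \in s.
Proof. by case/and4P=> _ _ _; case: s => // x s _; apply: mem_last. Qed.

Lemma sumn_dpart N s B : is_dpart N s -> largest_part s < B ->
  N = \sum_(0 <= x < B) (x \in s) * x.
Proof.
case/and4P=> s_srt _ /eqP <- _ sB; apply: sumn_sorted_ltn => //.
apply/allP => x /(sorted_ltn_le_last s_srt) /=.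
by move: sB; rewrite /largest_part; lia.
Qed.

(* The excess of the pair {M - i, L - M + i}, whose sum is L, over its minimal
   contribution M - i, provided one of its members is in s. *)
Definition gain (s : seq nat) M L i :=
  (L - M + i \in s) * (if M - i \in s then L - M + i else L - M.*2 + i.*2).

(** If both members of a pair were missing, they would refine the part [L]. So each pair contributes
    at least its smaller member [M - i], and [gain] is the surplus. *)
Lemma sumn_unrefinable N s M (L := largest_part s) :
  is_dpart N s -> ~~ refinable s -> M.*2 < L ->
  N = (M * M.+1)./2 + \sum_(i < M) gain s M L i
      + \sum_(M.+1 <= x < L - M) (x \in s) * x + L.
Proof.
move=> sP sU ltML; rewrite {1}(sumn_dpart sP (ltnSn _)) -/L.
have Ls : L \in s by apply: largest_part_mem sP.
rewrite (@sum_pairs (fun x => (x \in s) * x) M) // muln0 add0n Ls mul1n.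
rewrite -sum_rev_half -big_split /=; congr (_ + _ + _).
apply: eq_bigr => i _; have iM := ltn_ord i.
have := @unrefinable_pair s (M - i) (L - M + i) sU.
rewrite (_ : M - i + _ = L); last lia.
move=> /(_ erefl Ls); rewrite /gain.
by case: (M - i \in s); case: (L - M + i \in s) => /=; lia.
Qed.

Lemma largest_part_le m e s : ~~ odd e -> e <= m.+1 ->
  is_dpart ((m * m.+1)./2 + m.*2.+1 + e) s -> ~~ refinable s ->
  largest_part s <= m.*2.+1.
Proof.
move=> e_even e_le sP sU; rewrite leqNgt; apply/negP => lt_L.
have [L_eq|L_neq] := eqVneq (largest_part s) m.*2.+2; last first.
  (* With m + 1 pairs the sum is at least (m + 1)(m + 2)/2 + L, which is too large once L >= 2m +
     3. *)
  have := @sumn_unrefinable _ s m.+1 sP sU; lia.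
have := @sumn_unrefinable _ s m sP sU; rewrite L_eq.
rewrite (_ : m.*2.+2 - m = m.+2); last lia.
rewrite big_nat1 => /(_ ltac:(lia)); set G := \sum_(i < m) _ => Neq.
case: (boolP (odd G)) => [|G_even]; last by case: (m.+1 \in s) Neq; lia.
apply/negP; apply: sum_odd_double => i.
(* Keeping both members would gain at least m + 2, while [G] is at most m; the remaining gains are 0
   or 2i + 2. *)
have : gain s m m.*2.+2 i <= G by rewrite /G (bigD1 i) //= leq_addr.
by rewrite /gain; case: (_ \in s); case: (_ \in s) => /=; lia.
Qed.

(** * The maps between odd and unrefinable partitions *)

(* A partition l into distinct odd parts records which low elements m - i are
   exchanged for m + 1 + i, namely those with 2i + 1 in l. For l = {1, m} the
   result would be refinable when m is odd: ((m + 1)/2) + m is one of its parts.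
   This l is sent instead to {1, ..., m + 1, 2m + 1}, which has the same sum. *)
Definition unref_of_odd m (l : seq nat) : seq nat :=
  [seq x <- iota 0 m.*2.+2 |
    if l == [:: 1; m] then (0 < x <= m.+1) || (x == m.*2.+1)
    else if x <= m then (0 < x) && ((m - x).*2.+1 \notin l)
    else (x == m.*2.+1) || ((x - m.+1).*2.+1 \in l)].

(** Exchanges keep exactly one of [m] and [m.+1], so the presence of both marks the exceptional
    partition. *)
Definition odd_of_unref m (s : seq nat) : seq nat :=
  if (m \in s) && (m.+1 \in s) then [:: 1; m]
  else [seq g <- iota 0 m.*2 | odd g && (m.+1 + g./2 \in s)].

Lemma unref_of_odd_sorted m l : sorted ltn (unref_of_odd m l).
Proof.
by apply: sorted_filter (iota_ltn_sorted 0 _) => y x z; apply: ltn_trans.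
Qed.

Lemma mem_unref_of_odd_special m x : (x \in unref_of_odd m [:: 1; m]) =
  (0 < x < m.*2.+2) && ((x <= m.+1) || (x == m.*2.+1)).
Proof. by rewrite mem_filter eqxx mem_iota; lia. Qed.

Lemma mem_unref_of_odd_low m l i : l != [:: 1; m] -> i < m ->
  (m - i \in unref_of_odd m l) = (i.*2.+1 \notin l).
Proof.
move=> /negPf lN im; rewrite mem_filter lN mem_iota leq_subr subn_gt0 im /=.
have -> : m - (m - i) = i by lia.
have -> : m - i < 0 + m.*2.+2 by lia.
by rewrite andbT.
Qed.

Lemma mem_unref_of_odd_high m l i : l != [:: 1; m] -> i < m ->
  (m.+1 + i \in unref_of_odd m l) = (i.*2.+1 \in l).
Proof.
move=> /negPf lN im; rewrite mem_filter lN mem_iota leqNgt ltnS leq_addr /=.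
have -> : m.+1 + i == m.*2.+1 = false by lia.
have -> : m.+1 + i < 0 + m.*2.+2 by lia.
by rewrite addKn andbT.
Qed.

Lemma last_unref_of_odd m l : largest_part (unref_of_odd m l) = m.*2.+1.
Proof.
(* The last index of the range, 2m + 1, is split off; both branches keep it. *)
rewrite /unref_of_odd -[X in iota _ X]addn1 iotaD filter_cat /= add0n.
have -> : m.*2.+1 <= m = false by lia.
rewrite eqxx orbT orTb.
rewrite if_same.
by rewrite /largest_part last_cat.
Qed.

(** * From odd partitions to unrefinable ones *)

Lemma odd_part_lt e l x : ~~ odd e -> is_dpart e l -> all odd l ->
  x \in l -> odd x /\ x < e.
Proof.
move=> e_even /and4P[_ _ /eqP le _] /allP l_odd xl; split; first exact: l_odd.
have := sumn_rem xl; have := l_odd x xl; lia.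
Qed.

Lemma sumn_odd e l m : ~~ odd e -> e <= m.+1 -> is_dpart e l -> all odd l ->
  e = \sum_(i < m) (i.*2.+1 \in l) * i.*2.+1.
Proof.
move=> e_even e_le lP l_odd; have /and4P[l_srt _ /eqP le _] := lP.
rewrite -(@sum_odd_part (fun x => (x \in l) * x) m) => [|x x_even].
  rewrite -{1}le; apply: sumn_sorted_ltn => //; apply/allP => x xl /=.
  have [x_odd x_lt] := odd_part_lt e_even lP l_odd xl.
  move: x_odd x_lt; case: x {xl} => // x; lia.
case xl: (x \in l) => //; have /allP/(_ x xl) := l_odd.
by rewrite (negPf x_even).
Qed.

(** A third part would be positive and push the sum past [e]. *)
Lemma dpart_pair_eq e l x y : is_dpart e l -> x < y -> x \in l -> y \in l ->
  x + y = e -> l = [:: x; y].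
Proof.
move=> /and4P[l_srt /allP l_pos /eqP le _] xy xl yl xye.
apply: (irr_sorted_eq ltn_trans ltnn) => // [|z]; first by rewrite /= xy.
rewrite !inE; apply/idP/idP => [zl|/orP[]/eqP-> //].
apply/negPn/negP; rewrite negb_or => /andP[zx zy].
have := @leq_sumn_sub [:: x; y; z] l; rewrite /= !inE negb_or.
rewrite !(eq_sym _ z) zx zy (ltn_eqF xy) /= => /(_ isT).
have := l_pos z zl => /= z0 H.
have : x + (y + (z + 0)) <= sumn l.
  by apply: H => t; rewrite !inE => /or3P[]/eqP->.
lia.
Qed.

(** Exchanging m - i for m + 1 + i adds 2i + 1, so the exchanges add [e] in total; in the
    exceptional case the extra part m + 1 = e does so. *)
Lemma unref_of_odd_dpart m e l : ~~ odd e -> 0 < e <= m.+1 -> 1 < m ->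
  is_dpart e l -> all odd l ->
  is_dpart ((m * m.+1)./2 + m.*2.+1 + e) (unref_of_odd m l).
Proof.
move=> e_even /andP[e_gt0 e_le] m_gt1 lP l_odd; set s := unref_of_odd m l.
have s_srt : sorted ltn s by apply: unref_of_odd_sorted.
have s_last : largest_part s = m.*2.+1 by apply: last_unref_of_odd.
have s_lt : all (gtn m.*2.+2) s.
  by apply/allP => x; rewrite mem_filter mem_iota => /and3P[].
have s0 : 0 \notin s by rewrite mem_filter /=; case: ifP.
have sL : m.*2.+1 \in s.
  rewrite mem_filter mem_iota eqxx orbT (_ : m.*2.+1 <= m = false); last lia.
  rewrite orTb.
  by rewrite if_same; lia.
have s_sum : sumn s = (m * m.+1)./2 + m.*2.+1 + e.
  rewrite (sumn_sorted_ltn s_srt s_lt).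
  rewrite (@sum_pairs (fun x => (x \in s) * x) m) // muln0 add0n sL mul1n.
  rewrite (_ : m.*2.+1 - m = m.+1) ?big_geq ?addn0; try lia.
  have [l1m|lN] := eqVneq l [:: 1; m].
    have e_eq : e = m.+1.
      by case/and4P: lP => _ _ /eqP <- _; rewrite l1m /=; lia.
    rewrite (eq_bigr (fun i : 'I_m => (m - i) + (i == 0 :> nat) * m.+1)).
      rewrite big_split /= sum_rev_half.
      have [m' m_eq] : exists m', m = m'.+1 by exists m.-1; lia.
      rewrite e_eq m_eq big_ord_recl big1 ?addn0 //=; lia.
    move=> i _; have im := ltn_ord i; rewrite /s l1m !mem_unref_of_odd_special.
    have -> : 0 < m - i < m.*2.+2 by lia.
    have -> : m - i <= m.+1 by lia.
    have [->|i0] := eqVneq (i : nat) 0; first by rewrite addn0 leqnn /=; lia.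
    by rewrite mul0n; case: (_ && _) / andP => //; lia.
  rewrite [X in _ = _ + X](sumn_odd e_even e_le lP l_odd) -sum_rev_half addnAC.
  rewrite -big_split /=.
  congr (_ + _); apply: eq_bigr => i _; have im := ltn_ord i.
  rewrite /s mem_unref_of_odd_low // mem_unref_of_odd_high //.
  by case: (_ \in l); rewrite /=; lia.
apply/and4P; split=> //.
- by apply/allP => -[|x] //; rewrite (negPf s0).
- exact/eqP.
(* A single part would equal 2m + 1, but the sum is larger. *)
- move: s_sum s_last; rewrite /largest_part.
  by case: (s) => [|x [|y s']] //=; lia.
Qed.

Lemma unref_of_odd_unrefinable m e l : ~~ odd e -> 0 < e <= m.+1 -> 1 < m ->
  is_dpart e l -> all odd l -> ~~ refinable (unref_of_odd m l).
Proof.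
move=> e_even e_bd m_gt1 lP l_odd; have /andP[e_gt0 e_le] := e_bd.
have sP := unref_of_odd_dpart e_even e_bd m_gt1 lP l_odd.
have s_last := last_unref_of_odd m l.
have sL := largest_part_mem sP; rewrite s_last in sL; clear sP.
apply/refinableP => -[a [b []]]; rewrite !missing_partsE s_last.
wlog ab : a b / a < b => [IH|].
  move=> am bm; rewrite neq_ltn => /orP[]lt; first by apply: IH => //; lia.
  by rewrite addnC; apply: IH => //; lia.
move=> /and3P[a0 _ am] /and3P[b0 bL bm] _ abs.
have := sorted_ltn_le_last (unref_of_odd_sorted m l) abs.
rewrite -/(largest_part _) s_last => ab_le.
have [l1m|lN] := eqVneq l [:: 1; m].
  (* Here all missing parts exceed m + 1, so two of them add up to more than 2m + 1. *)
  by move: am bm; rewrite l1m !mem_unref_of_odd_special; lia.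
have low x : 0 < x <= m -> x \notin unref_of_odd m l ->
    exists i, [/\ x = m - i, i.*2.+1 \in l & i.*2.+1 <= m].
  move=> x_bd; have x_eq : x = m - (m - x) by lia.
  rewrite x_eq mem_unref_of_odd_low ?negbK //; last lia.
  by exists (m - x); split=> //; have [] := odd_part_lt e_even lP l_odd H; lia.
have [i [a_eq il im]] := low a ltac:(lia) am.
have [b_le|b_gt] := leqP b m.
  have [j [b_eq jl jm]] := low b ltac:(lia) bm.
  have ij : i.*2.+1 + j.*2.+1 <= e.
    case/and4P: lP => _ _ /eqP <- _.
    have := @leq_sumn_sub [:: i.*2.+1; j.*2.+1] l; rewrite /= addn0 inE => -> //.
      by lia.
    by move=> t; rewrite !inE => /orP[]/eqP->.
  (* The parts 2i + 1, 2j + 1 and 2h + 1 of [l] total 2m + 1 > e, so they are not distinct. If h =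
     i, then j = 0 and 2i + 1 = m, giving the excluded {1, m}; h = j contradicts j < i. *)
  pose h := m - i - j - 1.
  move: abs; rewrite (_ : a + b = m.+1 + h); last lia.
  rewrite mem_unref_of_odd_high //; last lia.
  move=> hl; case: (eqVneq h i) => [hi|hNi].
    case/eqP: lN; rewrite (@dpart_pair_eq e l j.*2.+1 i.*2.+1) //; try lia.
    by congr [:: _; _]; lia.
  case: (eqVneq h j) => [hj|hNj]; first by lia.
  have : i.*2.+1 + (j.*2.+1 + (h.*2.+1 + 0)) <= e.
    case/and4P: lP => _ _ /eqP <- _.
    apply: (@leq_sumn_sub [:: i.*2.+1; j.*2.+1; h.*2.+1]).
      by rewrite /= !inE; lia.
    by move=> t; rewrite !inE => /or3P[]/eqP->.
  by lia.
pose j := b - m.+1; have b_eq : b = m.+1 + j by lia.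
move: (bm); rewrite b_eq mem_unref_of_odd_high //; last first.
  by case: (eqVneq b m.*2.+1) => [bE|]; [rewrite bE sL in bm | lia].
move=> jl; have [ij|ijN] := eqVneq i j; first by rewrite ij (negPf jl) in il.
(* Now j < i, and [a + b] would require the part 2(m - i + j) + 1 in [l]; it exceeds [e] because 2i
   + 1 <= m. *)
move: abs; rewrite (_ : a + b = m.+1 + (m - i + j)); last lia.
rewrite mem_unref_of_odd_high //; last lia.
by move=> hl; have [] := odd_part_lt e_even lP l_odd hl; lia.
Qed.

Lemma unref_of_oddK m e l : ~~ odd e -> 0 < e <= m.+1 -> 1 < m ->
  is_dpart e l -> all odd l -> odd_of_unref m (unref_of_odd m l) = l.
Proof.
move=> e_even /andP[e_gt0 e_le] m_gt1 lP l_odd; rewrite /odd_of_unref.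
have [->|lN] := eqVneq l [:: 1; m].
  by rewrite !mem_unref_of_odd_special; case: ifP => //; lia.
(* The pair i = 0 is {m, m + 1}: whether 1 is in [l] decides which single member is present. *)
have := @mem_unref_of_odd_low m l 0 lN; rewrite subn0 => -> //; last lia.
have := @mem_unref_of_odd_high m l 0 lN; rewrite addn0 => -> //; last lia.
rewrite andNb; have /and4P[l_srt _ _ _] := lP.
rewrite [RHS](@sorted_ltn_eq_filter l m.*2) //; last first.
  by apply/allP => x /(odd_part_lt e_even lP l_odd) /=; lia.
apply: eq_in_filter => g; rewrite mem_iota => g_lt.
case: (boolP (odd g)) => [g_odd|g_even] /=; last first.
  by symmetry; apply/negP => /(allP l_odd); apply/negP.
rewrite mem_unref_of_odd_high //; last lia.
by rewrite (_ : g./2.*2.+1 = g) //; lia.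
Qed.

(** * From unrefinable partitions back to odd ones *)

(** The pairs {m - i, m + 1 + i} with i < m exhaust 1, ..., 2m. *)
Lemma dpart_eq_pairs N N' m s s' : is_dpart N s -> is_dpart N' s' ->
  largest_part s = m.*2.+1 -> largest_part s' = m.*2.+1 ->
  (forall i, i < m -> (m - i \in s) = (m - i \in s') /\
    (m.+1 + i \in s) = (m.+1 + i \in s')) -> s = s'.
Proof.
move=> sP s'P sL s'L eq_pairs.
have /and4P[s_srt /allP s_pos _ _] := sP.
have /and4P[s'_srt /allP s'_pos _ _] := s'P.
apply: (irr_sorted_eq ltn_trans ltnn) => // x.
have [->|x_gt0] := posnP x.
  by apply/idP/idP => [/s_pos|/s'_pos].
have [x_gt|x_le] := ltnP m.*2.+1 x.
  by apply/idP/idP => /sorted_ltn_le_last; rewrite -/(largest_part _) ?sL ?s'L;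
    move=> /(_ ltac:(assumption)); lia.
have [->|xNL] := eqVneq x m.*2.+1.
  by rewrite -{1}sL -s'L !(largest_part_mem sP, largest_part_mem s'P).
have [x_le_m|x_gt_m] := leqP x m.
  have [] := eq_pairs (m - x) ltac:(lia).
  by rewrite (_ : m - (m - x) = x) //; lia.
by have [_] := eq_pairs (x - m.+1) ltac:(lia); rewrite subnKC.
Qed.

(* A pair with both members present costs m + 1 + i >= e on its own. *)
Lemma unrefinable_maximal_pairs m e s : ~~ odd e -> 0 < e <= m.+1 -> 1 < m ->
  is_dpart ((m * m.+1)./2 + m.*2.+1 + e) s -> ~~ refinable s ->
  largest_part s = m.*2.+1 ->
  if (m \in s) && (m.+1 \in s) then
    e = m.+1 /\ forall i, 0 < i < m -> (m - i \in s) && (m.+1 + i \notin s)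
  else e = \sum_(i < m) (m.+1 + i \in s) * i.*2.+1 /\
    forall i, i < m -> (m - i \in s) = (m.+1 + i \notin s).
Proof.
move=> e_even /andP[e_gt0 e_le] m_gt1 sP sU sL.
have Ls := largest_part_mem sP; rewrite sL in Ls.
have pair i : i < m -> (m - i \in s) || (m.+1 + i \in s).
  move=> im; have s_eq : m - i + (m.+1 + i) = m.*2.+1 by lia.
  by apply: unrefinable_pair; rewrite ?s_eq //; lia.
have e_eq : e = \sum_(i < m) gain s m m.*2.+1 i.
  have := @sumn_unrefinable _ s m sP sU; rewrite sL big_geq; last lia.
  by move=> /(_ ltac:(lia)); lia.
have gainE i : gain s m m.*2.+1 i =
    (m.+1 + i \in s) * (if m - i \in s then m.+1 + i else i.*2.+1).
  rewrite /gain (_ : m.*2.+1 - m = m.+1); last lia.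
  by rewrite (_ : m.*2.+1 - m.*2 + _ = i.*2.+1) //; lia.
have gain_le i : i < m -> gain s m m.*2.+1 i <= e.
  by move=> im; rewrite e_eq (bigD1 (Ordinal im)) //= leq_addr.
case: ifP => [/andP[ms m1s]|mm1].
  have gain0 : gain s m m.*2.+1 0 = m.+1.
    by rewrite gainE subn0 addn0 ms m1s mul1n.
  have e_m1 : e = m.+1 by have := gain_le 0 ltac:(lia); lia.
  split=> // i /andP[i_gt0 im].
  (* The pair {m, m + 1} uses up all of e = m + 1, so every other pair gains 0 and keeps only its
     low member. *)
  have : gain s m m.*2.+1 0 + gain s m m.*2.+1 i <= e.
    have m_gt0 : 0 < m by lia.
    rewrite e_eq (bigD1 (Ordinal m_gt0)) //= (bigD1 (Ordinal im)).
      by rewrite addnA leq_addr.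
    by rewrite -val_eqE /= -lt0n.
  rewrite gain0 e_m1 gainE; have := pair i im.
  by case: (m.+1 + i \in s); case: (m - i \in s) => //=; lia.
(* A pair kept whole gains m + 1 + i <= e <= m + 1, which forces the excluded i = 0. *)
have low i : i < m -> (m - i \in s) = (m.+1 + i \notin s).
  move=> im; have := gain_le i im; rewrite gainE; have := pair i im.
  case: (boolP (m.+1 + i \in s)) => [h1|_]; last by rewrite orbF => ->.
  case: (boolP (m - i \in s)) => //= h2 _.
  have [i0|] := posnP i; last lia.
  by move: mm1; rewrite i0 subn0 addn0 in h1 h2 *; rewrite h1 h2.
split=> //; rewrite e_eq; apply: eq_bigr => i _; rewrite gainE low //.
by case: (_ \in s).
Qed.

Lemma mem_odd_of_unref m s i : ~~ ((m \in s) && (m.+1 \in s)) -> i < m ->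
  (i.*2.+1 \in odd_of_unref m s) = (m.+1 + i \in s).
Proof.
move=> /negPf mm1 im; rewrite /odd_of_unref mm1 mem_filter mem_iota /=.
rewrite odd_double uphalf_double /= (_ : i.*2.+1 < _) ?andbT //; lia.
Qed.

Lemma odd_of_unref_dpart m e s : ~~ odd e -> 0 < e <= m.+1 -> 1 < m ->
  is_dpart ((m * m.+1)./2 + m.*2.+1 + e) s -> ~~ refinable s ->
  largest_part s = m.*2.+1 ->
  is_dpart e (odd_of_unref m s) && all odd (odd_of_unref m s).
Proof.
move=> e_even e_bd m_gt1 sP sU sL.
have := unrefinable_maximal_pairs e_even e_bd m_gt1 sP sU sL.
have [mm1 [e_eq _]|mm1 [e_eq _]] := ifPn.
  by rewrite /odd_of_unref mm1 /is_dpart /=; lia.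
have memE := @mem_odd_of_unref m s _ mm1.
set l := odd_of_unref m s in memE *.
have l_odd : all odd l.
  rewrite /l /odd_of_unref (negPf mm1); apply/allP => x.
  by rewrite mem_filter => /andP[/andP[]].
have l_lt : all (gtn m.*2) l.
  rewrite /l /odd_of_unref (negPf mm1); apply/allP => x.
  by rewrite mem_filter mem_iota => /and3P[].
have l_srt : sorted ltn l.
  rewrite /l /odd_of_unref (negPf mm1).
  by apply: sorted_filter (iota_ltn_sorted 0 _) => y x z; apply: ltn_trans.
have l_sum : sumn l = e.
  rewrite (sumn_sorted_ltn l_srt l_lt) (@sum_odd_part (fun x => (x \in l) * x)).
    by rewrite e_eq; apply: eq_bigr => i _; rewrite memE.
  by move=> x /negP x_even; case: (boolP (x \in l)) => // /(allP l_odd).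
rewrite l_odd andbT; apply/and4P; split=> //; last first.
(* A single odd part cannot have the even sum [e]. *)
- by move: l_sum l_odd e_bd e_even; case: (l) => [|x [|y l']] //=; lia.
- exact/eqP.
- by apply/allP => -[|x] // /(allP l_odd).
Qed.

Lemma odd_of_unrefK m e s : ~~ odd e -> 0 < e <= m.+1 -> 3 < m ->
  is_dpart ((m * m.+1)./2 + m.*2.+1 + e) s -> ~~ refinable s ->
  largest_part s = m.*2.+1 -> unref_of_odd m (odd_of_unref m s) = s.
Proof.
move=> e_even e_bd m_gt3 sP sU sL; have m_gt1 : 1 < m by lia.
have /andP[lP l_odd] := odd_of_unref_dpart e_even e_bd m_gt1 sP sU sL.
have s'P := unref_of_odd_dpart e_even e_bd m_gt1 lP l_odd.
apply: (@dpart_eq_pairs _ _ m _ _ s'P sP) => //; first exact: last_unref_of_odd.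
have := unrefinable_maximal_pairs e_even e_bd m_gt1 sP sU sL.
have [mm1 [e_eq pairs] i im|mm1 [e_eq pairs] i im] := ifPn.
  rewrite /odd_of_unref mm1 !mem_unref_of_odd_special.
  have [->|i_gt0] := posnP i.
    by rewrite subn0 addn0; case/andP: mm1 => -> ->; split; lia.
  have /andP[-> /negPf->] := pairs i ltac:(lia).
  by split; lia.
(* Were it {1, m} with m = 2j + 1, then m and m - j would be missing and add up to the part m + 1 +
   j. *)
have lN : odd_of_unref m s != [:: 1; m].
  apply/negP => /eqP l1m; case/negP: sU; apply/refinableP.
  have m_odd : odd m by apply: (allP l_odd); rewrite l1m !inE eqxx orbT.
  have m1s : m.+1 \in s.
    by rewrite -[m.+1]addn0 -mem_odd_of_unref // ?l1m ?inE //; lia.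
  pose j := m./2; have mj : m = j.*2.+1 by lia.
  have mjs : m.+1 + j \in s.
    by rewrite -mem_odd_of_unref // -?mj ?l1m ?inE ?eqxx ?orbT //; lia.
  exists m, (m - j); rewrite !missing_partsE sL pairs ?mjs; last lia.
  have := pairs 0; rewrite subn0 addn0 m1s => -> //; last lia.
  by rewrite (_ : m + (m - j) = m.+1 + j) ?mjs; [split=> //; lia | lia].
rewrite mem_unref_of_odd_low // mem_unref_of_odd_high // mem_odd_of_unref //.
by rewrite pairs.
Qed.

(** * The maximal largest part and the bijection *)

Lemma mem_Ustar m e (N := (m * m.+1)./2 + m.*2.+1 + e) (s : dpart N) :
  ~~ odd e -> 9 < e <= m.+1 ->
  (s \in Ustar N) = ~~ refinable s && (largest_part s == m.*2.+1).
Proof.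
move=> e_even e_bd; rewrite !inE; congr (_ && (_ == _)).
apply/eqP; rewrite eqn_leq; apply/andP; split.
  by apply/bigmax_leqP => l; rewrite inE; apply: largest_part_le (dpartP l); lia.
(* The image of this odd partition shows that the bound 2m + 1 is attained. *)
have lP : is_dpart e [:: 3; e - 3] by rewrite /is_dpart /=; lia.
have l_odd : all odd [:: 3; e - 3] by rewrite /=; lia.
have e_bd0 : 0 < e <= m.+1 by lia.
have m_gt1 : 1 < m by lia.
have sP := unref_of_odd_dpart e_even e_bd0 m_gt1 lP l_odd.
rewrite -(last_unref_of_odd m [:: 3; e - 3]).
rewrite (@leq_bigmax_cond _ _ (@largest_part \o @parts N) (DPart sP)) //.
by rewrite inE; apply: unref_of_odd_unrefinable lP l_odd.
Qed.

Lemma Ustar_Dodd_bij m e (N := (m * m.+1)./2 + m.*2.+1 + e) :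
  ~~ odd e -> 9 < e <= m.+1 ->
  exists f : {l : dpart N | l \in Ustar N} -> {l : dpart e | l \in Dodd e},
    bijective f.
Proof.
move=> e_even e_bd.
have e_bd0 : 0 < e <= m.+1 by lia.
have m_gt3 : 3 < m by lia.
have m_gt1 : 1 < m by lia.
pose US := {l : dpart N | l \in Ustar N}.
pose DO := {l : dpart e | l \in Dodd e}.
have UP (s : US) :
    ~~ refinable (val s) /\ largest_part (val s) = m.*2.+1.
  by have := valP s; rewrite mem_Ustar // => /andP[? /eqP].
have DP (l : DO) : all odd (val l).
  by have := valP l; rewrite inE.
have fP (s : US) :
    is_dpart e (odd_of_unref m (val s)) && all odd (odd_of_unref m (val s)).
  by have [sU sL] := UP s; apply: odd_of_unref_dpart (dpartP (val s)) sU sL.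
have f_mem (s : US) : DPart (proj1 (andP (fP s))) \in Dodd e.
  by rewrite inE; case/andP: (fP s).
have gP (l : DO) := unref_of_odd_dpart e_even e_bd0 m_gt1 (dpartP (val l)) (DP l).
have g_mem (l : DO) : DPart (gP l) \in Ustar N.
  rewrite mem_Ustar // last_unref_of_odd eqxx andbT.
  exact: unref_of_odd_unrefinable e_even e_bd0 m_gt1 (dpartP (val l)) (DP l).
exists (fun s : US => exist (fun l => l \in Dodd e) _ (f_mem s)).
exists (fun l : DO => exist (fun s => s \in Ustar N) _ (g_mem l)).
  move=> s; do 2!apply: val_inj; have [sU sL] := UP s.
  exact: odd_of_unrefK e_even e_bd0 m_gt3 (dpartP (val s)) sU sL.
move=> l; do 2!apply: val_inj.
exact: unref_of_oddK e_even e_bd0 m_gt1 (dpartP (val l)) (DP l).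
Qed.

Theorem theorem3p22 (n k d : nat) (hn : 11 <= n) (hk : 0 < k)
    (hd : d = n - 2 * k) (hd4 : 4 <= d) (hdn : d <= n - 8) :
  (exists f : {l : dpart (T n d) | l \in Ustar (T n d)} ->
              {l : dpart (2 * (k + 1)) | l \in Dodd (2 * (k + 1))},
     bijective f)
  /\ #|Ustar (T n d)| = #|Dodd (2 * (k + 1))|.
Proof.
have [m n_eq] : exists m, n = m + 3 by exists (n - 3); lia.
(* With e = 2(k + 1) = n - d + 2, the bound d >= 4 gives e <= m + 1 and d <= n - 8 gives e >= 10. *)
have -> : T n d = (m * m.+1)./2 + m.*2.+1 + 2 * (k + 1) by rewrite /T; nia.
have [||f f_bij] := @Ustar_Dodd_bij m (2 * (k + 1)); try lia.
split; first by exists f.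
by have := bij_eq_card f_bij; rewrite !card_sig.
Qed.
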